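(* Define $\Phi(\mathbf{x}) = \sum_{\ell=1}^n \frac{x_\ell}{1+x_\ell}$ for $\mathbf{x}=(\mathrm{Inf}_1(f),\dots,\mathrm{Inf}_n(f))\in[0,1]^n$. Then: (i) $\Phi$ is strictly Schur-concave: if $\mathbf{x}\succ\mathbf{y}$ (majorization) and $\mathbf{x}$ is not a permutation of $\mathbf{y}$, then $\Phi(\mathbf{x})<\Phi(\mathbf{y})$. (When $\mathbf{x}$ is a permutation of $\mathbf{y}$, $\Phi(\mathbf{x})=\Phi(\mathbf{y})$ since $\Phi$ is symmetric.) (ii) Consequently, $\mu(f)=2^{-\Phi(\mathbf{x})}$ is strictly Schur-convex in the same sense: more concentrated influence (in the strict majorization order, modulo permutation) yields strictly larger $\mu$. For fixed total influence $I=\sum_\ell x_\ell$, $\mu$ is minimized when influences are uniform ($x_\ell=I/n$ for all $\ell$) and maximized when influences are maximally concentrated on a single coordinate. (iii) In particular, $\mu$ strictly orders functions by their influence distribution: if $I(f)=I(g)$, $\mathbf{x}(f)\succ\mathbf{x}(g)$, and the influence vectors are not permutations of one another, then $\mu(f)>\mu(g)$.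
   Context: Majorization: for $\mathbf{x},\mathbf{y}\in\mathbb{R}^n$, $\mathbf{x}\succ\mathbf{y}$ means $\sum_i x_i=\sum_i y_i$ and, for each $k<n$, the sum of the $k$ largest entries of $\mathbf{x}$ is at least the sum of the $k$ largest entries of $\mathbf{y}$. For a Boolean function $f:\{-1,+1\}^n\to\{-1,+1\}$, $\mathrm{Inf}_\ell(f)=\Pr_x[f(x)\ne f(x^{\oplus\ell})]\in[0,1]$ ($x$ uniform on $\{-1,+1\}^n$, $x^{\oplus\ell}$ is $x$ with coordinate $\ell$ flipped); the influence vector is $\mathbf{x}(f)=(\mathrm{Inf}_1(f),\dots,\mathrm{Inf}_n(f))$; the total influence is $I(f)=\sum_{\ell=1}^n\mathrm{Inf}_\ell(f)\in[0,n]$; and the BBT contraction invariant is $\mu(f)=\prod_{\ell=1}^n 2^{-\mathrm{Inf}_\ell(f)/(1+\mathrm{Inf}_\ell(f))}=2^{-\Phi(\mathbf{x}(f))}$. Here $f,g$ are Boolean functions on $n$ variables. *)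

(* Defs.v *)
From mathcomp Require Import all_boot all_order all_algebra all_fingroup.
From mathcomp Require Import all_classical all_reals all_analysis.

Set Implicit Arguments.
Unset Strict Implicit.
Unset Printing Implicit Defensive.

Import Order.TTheory GRing.Theory Num.Theory.

Local Open Scope ring_scope.

(* The sign set {-1,+1} is encoded by bool: b stands for (-1) ^+ b. *)
Definition bcube (n : nat) := {ffun 'I_n -> bool}.
Definition boolfun (n : nat) := bcube n -> bool.

Definition flip (n : nat) (l : 'I_n) (x : bcube n) : bcube n :=
  [ffun i => if i == l then ~~ x i else x i].

Definition unifPr (R : realType) (T : finType) (A : {set T}) : R :=
  #|A|%:R / #|T|%:R.

Definition influence (R : realType) (n : nat) (f : boolfun n) (l : 'I_n) : R :=
  unifPr R [set x : bcube n | f x != f (flip l x)].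

Definition influences (R : realType) (n : nat) (f : boolfun n) : 'rV[R]_n :=
  \row_(l < n) influence R f l.

Definition total_influence (R : realType) (n : nat) (f : boolfun n) : R :=
  \sum_(l < n) influence R f l.

Definition bbt_mu (R : realType) (n : nat) (f : boolfun n) : R :=
  \prod_(l < n) 2 `^ (- (influence R f l / (1 + influence R f l))).

Section Majorization.
Context (R : realType) (n : nat).
Implicit Types (x y : 'rV[R]_n) (F : 'rV[R]_n -> R).

Definition in_unit_cube x : Prop := forall i, 0 <= x 0 i <= 1.

Definition vsum x : R := \sum_(i < n) x 0 i.

Definition top_sum (k : nat) x : R :=
  \sum_(v <- take k (sort >=%R [seq x 0 i | i <- enum 'I_n])) v.

Definition majorizes x y : Prop :=
  vsum x = vsum y /\
  forall k : nat, (k < n)%N -> top_sum k y <= top_sum k x.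

Definition permuted x y : Prop := exists s : 'S_n, x = col_perm s y.

Definition strictly_schur_concave_on (D : 'rV[R]_n -> Prop) F : Prop :=
  forall x y, D x -> D y -> majorizes x y -> ~ permuted x y -> F x < F y.

Definition strictly_schur_convex_on (D : 'rV[R]_n -> Prop) F : Prop :=
  forall x y, D x -> D y -> majorizes x y -> ~ permuted x y -> F y < F x.

Definition Phi x : R := \sum_(l < n) x 0 l / (1 + x 0 l).

(* Extends bbt_mu from influence vectors to arbitrary vectors. *)
Definition mu_vec x : R := 2 `^ (- Phi x).

Definition with_total (I : R) x : Prop := in_unit_cube x /\ vsum x = I.

Definition uniform_vec (I : R) : 'rV[R]_n := const_mx (I / n%:R).

(* I e_j; it lies in [0,1]^n only if 0 <= I <= 1. *)
Definition single_vec (I : R) (j : 'I_n) : 'rV[R]_n := I *: delta_mx 0 j.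

(* (1, ..., 1, I - floor I, 0, ..., 0): the mass I is put on one coordinate up
   to the cap 1, the excess on the next one, and so on.  For 0 <= I <= 1 this
   is (I, 0, ..., 0). *)
Definition capped_vec (I : R) : 'rV[R]_n :=
  \row_(l < n) Num.min 1 (Num.max 0 (I - l%:R)).

End Majorization.

(* Main.v *)
Require Import Defs.
From mathcomp Require Import all_boot all_order all_algebra all_fingroup.
From mathcomp Require Import all_classical all_reals all_analysis.
From mathcomp Require Import ring lra.

Set Implicit Arguments.
Unset Strict Implicit.
Unset Printing Implicit Defensive.

Import Order.TTheory GRing.Theory Num.Theory.

Local Open Scope ring_scope.

(* The function v / (1 + v) lies strictly below each of its tangents away from
   the point of tangency.  Sort x and y decreasingly and compare each x_i with
   the tangent at y_i: Phi x <= Phi y + sum_i (1 + y_i)^-2 (x_i - y_i), strictly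
   unless the sorted vectors agree.  The slopes (1 + y_i)^-2 increase with i and
   the partial sums of x_i - y_i are nonnegative with total 0, so Abel summation
   makes the last sum nonpositive.  The same bound handles the capped vector,
   whose k-th partial sum min(k, I) is as large as the cube allows; the uniform
   vector only needs one common tangent, and I e_j only x_i <= I. *)

(** * Abel summation and the tangent-line bound *)

Lemma abel_sum_ge0 (R : realDomainType) (n : nat) (c d : nat -> R) :
  (forall i, (i.+1 < n)%N -> c i <= c i.+1) ->
  (forall k, (k < n)%N -> \sum_(i < k) d i <= 0) ->
  \sum_(i < n) d i = 0 -> 0 <= \sum_(i < n) c i * d i.
Proof.
case: n => [|n] c_le d_le0 d_sum0; first by rewrite big_ord0.
(* Strengthened for induction: each weighted prefix is bounded below by its last weight times the
   plain prefix sum. At [m = n] that sum is the full one, which is 0. *)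
suff H m : (m <= n)%N ->
    c m * (\sum_(i < m.+1) d i) <= \sum_(i < m.+1) c i * d i.
  by have := H n (leqnn n); rewrite d_sum0 mulr0.
elim: m => [|m IHm] lt_mn; first by rewrite !big_ord1.
rewrite big_ord_recr [leRHS]big_ord_recr /= mulrDr lerD2r.
apply: le_trans (IHm (ltnW lt_mn)).
(* Passing to the larger weight [c m.+1] lowers the bound, since the prefix sum is nonpositive. *)
by apply: ler_wnM2r; [exact: d_le0 | exact: c_le].
Qed.

(** The gap is an explicit square over a positive denominator, which gives both the inequality and
    its equality case. *)
Lemma ratio_le_tangent (R : realFieldType) (u v : R) : 0 <= u -> 0 <= v ->
  v / (1 + v) <= u / (1 + u) + (1 + u) ^- 2 * (v - u) ?= iff (v == u).
Proof.
move=> u_ge0 v_ge0.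
have u1 : 0 < 1 + u by lra.
have v1 : 0 < 1 + v by lra.
have gapE : u / (1 + u) + (1 + u) ^- 2 * (v - u) - v / (1 + v)
            = (v - u) ^+ 2 / ((1 + u) ^+ 2 * (1 + v)).
  by field; rewrite !gt_eqF.
have den_gt0 : 0 < (1 + u) ^+ 2 * (1 + v) by rewrite mulr_gt0 ?exprn_gt0.
split; first by rewrite -subr_ge0 gapE divr_ge0 ?sqr_ge0 ?ltW.
rewrite eq_sym -subr_eq0 gapE mulf_eq0 sqrf_eq0 invr_eq0 (gt_eqF den_gt0).
by rewrite orbF subr_eq0.
Qed.

(* The tangent slopes [(1 + b i) ^- 2] increase with [i], so the tangent-line
   errors sum to a nonnegative amount by Abel summation. *)
Lemma sum_ratio_le (R : realFieldType) (n : nat) (a b : nat -> R) :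
  (forall i, (i < n)%N -> 0 <= a i) -> (forall i, (i < n)%N -> 0 <= b i) ->
  (forall i, (i.+1 < n)%N -> b i.+1 <= b i) ->
  (forall k, (k < n)%N -> \sum_(i < k) b i <= \sum_(i < k) a i) ->
  \sum_(i < n) a i = \sum_(i < n) b i ->
  \sum_(i < n) a i / (1 + a i) <= \sum_(i < n) b i / (1 + b i)
    ?= iff [forall i : 'I_n, a i == b i].
Proof.
move=> a_ge0 b_ge0 b_noninc prefix_le sum_eq.
pose t (i : nat) : R := (1 + b i) ^- 2 * (a i - b i).
have tangents : \sum_(i < n) a i / (1 + a i)
    <= \sum_(i < n) (b i / (1 + b i) + t i) ?= iff [forall i : 'I_n, a i == b i].
  apply: leif_sum => i _.
  by apply: ratio_le_tangent; [exact: b_ge0 | exact: a_ge0].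
rewrite big_split /= in tangents.
have t_le0 : \sum_(i < n) t i <= 0.
  (* The sign is flipped so that Abel summation applies to [b i - a i], whose prefix sums are
     nonpositive. *)
  rewrite -oppr_ge0 -sumrN.
  under eq_bigr => i _ do rewrite /t -mulrN opprB.
  apply: (@abel_sum_ge0 _ _ (fun i => (1 + b i) ^- 2) (fun i => b i - a i)) => /=.
  - move=> i lt_in; have bS_ge0 := b_ge0 _ lt_in.
    have b_le := b_noninc _ lt_in.
    have p1 : 0 < 1 + b i.+1 by lra.
    have p2 : 0 < 1 + b i by lra.
    by rewrite lef_pV2 ?posrE ?exprn_gt0 // lerXn2r ?nnegrE ?lerD2l // ltW.
  - by move=> k lt_kn; rewrite sumrB subr_le0 prefix_le.
  - by rewrite sumrB sum_eq subrr.
split; first by apply: le_trans tangents.1 _; rewrite gerDl.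
apply/idP/idP => [/eqP sums_eq | /forallP ab].
  (* The tangent bound is squeezed between two equal sums, so it is attained, which forces termwise
     equality. *)
  by rewrite -tangents.2 eq_le tangents.1 sums_eq gerDl.
by apply/eqP; apply: eq_bigr => i _; rewrite (eqP (ab i)).
Qed.

(** * Decreasing rearrangements and strict Schur-concavity *)

Section PhiExtrema.
Context (R : realType) (n : nat).
Implicit Types x y : 'rV[R]_n.

Let entries x := [seq x 0 i | i <- enum 'I_n].
(** Indexed by [nat] to fit the sequences of [sum_ratio_le]; the default 0 is never reached for
    [i < n]. *)
Let sorted_entry x (i : nat) : R := nth 0 (sort >=%R (entries x)) i.

Lemma size_sorted_entries x : size (sort >=%R (entries x)) = n.
Proof. by rewrite size_sort size_map size_enum_ord. Qed.

Lemma sum_sorted_entry x (F : R -> R) :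
  \sum_(i < n) F (sorted_entry x i) = \sum_(i < n) F (x 0 i).
Proof.
transitivity (\sum_(v <- sort >=%R (entries x)) F v).
  by rewrite (big_nth 0) size_sorted_entries big_mkord.
rewrite (perm_big (entries x)) /=; last by rewrite perm_sort.
by rewrite big_map big_enum.
Qed.

Lemma top_sumE x k : (k <= n)%N ->
  top_sum k x = \sum_(i < k) sorted_entry x i.
Proof.
move=> le_kn; rewrite /top_sum (big_nth 0) size_takel ?size_sorted_entries //.
by rewrite big_mkord; apply: eq_bigr => i _; rewrite nth_take.
Qed.

Lemma sorted_entryP x (P : R -> Prop) : (forall j, P (x 0 j)) ->
  forall i, (i < n)%N -> P (sorted_entry x i).
Proof.
move=> Px i lt_in; have: sorted_entry x i \in entries x.
  by rewrite -(mem_sort >=%R) mem_nth ?size_sorted_entries.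
by case/mapP => j _ ->.
Qed.

Lemma sorted_entry_noninc x i : (i.+1 < n)%N ->
  sorted_entry x i.+1 <= sorted_entry x i.
Proof.
move=> lt_in.
have geT : total (>=%R : rel R) by move=> u v; exact: le_total.
have ge_trans : transitive (>=%R : rel R) by move=> u v w /= vu /le_trans; apply.
apply: (sorted_leq_nth ge_trans _ 0 (sort_sorted geT (entries x))) => //.
- by move=> u /=.
- by rewrite inE size_sorted_entries ltnW.
- by rewrite inE size_sorted_entries.
Qed.

(** Equal sorted sequences make the entry tuples [perm_eq], and [tuple_permP] extracts the index
    permutation. This turns the equality case of [sum_ratio_le] into [permuted]. *)
Lemma sorted_entry_permuted x y :
  (forall i, (i < n)%N -> sorted_entry x i = sorted_entry y i) -> permuted x y.
Proof.
move=> xy.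
have : perm_eq [tuple x 0 i | i < n] [tuple y 0 i | i < n].
  have -> : tval [tuple x 0 i | i < n] = entries x by [].
  have -> : tval [tuple y 0 i | i < n] = entries y by [].
  rewrite -(perm_sort >=%R) perm_sym -(perm_sort >=%R).
  suff -> : sort >=%R (entries x) = sort >=%R (entries y) by [].
  apply: (@eq_from_nth _ 0); rewrite !size_sorted_entries //.
case/tuple_permP => p xyp; exists p; apply/rowP => i; rewrite mxE.
have /(congr1 (fun t : n.-tuple R => tnth t i)) := val_inj xyp.
by rewrite !tnth_mktuple.
Qed.

Lemma Phi_majorizes x y : in_unit_cube x -> in_unit_cube y ->
  majorizes x y -> ~ permuted x y -> Phi x < Phi y.
Proof.
move=> xC yC [xy_sum xy_top] not_perm.
have [] := @sum_ratio_le R n (sorted_entry x) (sorted_entry y).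
- by apply: (sorted_entryP (P := fun v => 0 <= v)) => j; case/andP: (xC j).
- by apply: (sorted_entryP (P := fun v => 0 <= v)) => j; case/andP: (yC j).
- exact: sorted_entry_noninc.
- by move=> k lt_kn; rewrite -!top_sumE ?xy_top // ltnW.
- by rewrite !(sum_sorted_entry _ idfun).
rewrite !(sum_sorted_entry _ (fun v => v / (1 + v))) => le_xy eq_xy.
rewrite lt_neqAle le_xy eq_xy andbT.
apply/negP => /forallP xy; apply: not_perm.
apply: sorted_entry_permuted => i lt_in.
exact: eqP (xy (Ordinal lt_in)).
Qed.

Lemma Phi_permuted x y : permuted x y -> Phi x = Phi y.
Proof.
case=> s ->; rewrite [RHS](reindex_inj (@perm_inj _ s)).
by apply: eq_bigr => i _; rewrite mxE.
Qed.

(** * Extremal vectors for a fixed total *)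

Lemma sum_capped (I : R) (k : nat) : 0 <= I ->
  \sum_(i < k) Num.min 1 (Num.max 0 (I - i%:R)) = Num.min k%:R I.
Proof.
move=> I_ge0; elim: k => [|k IHk]; first by rewrite big_ord0 min_l.
rewrite big_ord_recr /= IHk -natr1 /Num.min /Num.max.
by do ![case: ifPn]; rewrite -?leNgt; lra.
Qed.

Lemma Phi_capped_le (I : R) x : with_total I x -> Phi (capped_vec n I) <= Phi x.
Proof.
case=> xC xI.
have x_ge0 i : 0 <= x 0 i by case/andP: (xC i).
have x_le1 i : x 0 i <= 1 by case/andP: (xC i).
have I_ge0 : 0 <= I by rewrite -xI sumr_ge0.
have I_le : I <= n%:R.
  rewrite -xI -[n in n%:R]card_ord -sumr_const; exact: ler_sum.
pose a (i : nat) : R := Num.min 1 (Num.max 0 (I - i%:R)).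
have -> : Phi (capped_vec n I) = \sum_(i < n) a i / (1 + a i).
  by apply: eq_bigr => i _; rewrite mxE.
rewrite /Phi -(sum_sorted_entry x (fun v => v / (1 + v))).
have sx_ge0 := sorted_entryP (P := fun v => 0 <= v) x_ge0.
have sx_sum : \sum_(i < n) sorted_entry x i = I by rewrite (sum_sorted_entry x idfun).
case: (@sum_ratio_le R n a (sorted_entry x)) => //.
- by move=> i _; rewrite /a le_min le_max lexx ler01.
- exact: sorted_entry_noninc.
- move=> k lt_kn; rewrite sum_capped // le_min; apply/andP; split.
    rewrite -[k in k%:R]card_ord -sumr_const; apply: ler_sum => i _.
    by apply: (sorted_entryP (P := fun v => v <= 1)) => //; exact: ltn_trans lt_kn.
  (* For the bound by [I], the full sum is the prefix plus a nonnegative tail. *)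
  rewrite -sx_sum -(subnKC (ltnW lt_kn)) big_split_ord /= lerDl sumr_ge0 // => i _.
  by apply: sx_ge0; rewrite -[ltnRHS](subnKC (ltnW lt_kn)) ltn_add2l.
- by rewrite sum_capped // sx_sum min_r.
Qed.

Lemma with_total_capped (I : R) : 0 <= I <= n%:R -> with_total I (capped_vec n I).
Proof.
case/andP => I_ge0 I_le; split=> [i|].
  by rewrite mxE le_min le_max lexx ler01 ge_min lexx.
by rewrite /vsum (eq_bigr _ (fun i _ => mxE _ _ _ _)) sum_capped // min_r.
Qed.

(** Deviations from the mean sum to 0, so the linear terms of the tangent at [I / n%:R] cancel. *)
Lemma Phi_uniform_ge (I : R) x : with_total I x -> Phi x <= Phi (uniform_vec n I).
Proof.
case=> xC xI.
have x_ge0 i : 0 <= x 0 i by case/andP: (xC i).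
have u_ge0 : 0 <= I / n%:R by rewrite divr_ge0 // -xI sumr_ge0.
pose c := (1 + I / n%:R) ^- 2.
apply: (@le_trans _ _ (\sum_(i < n)
  (I / n%:R / (1 + I / n%:R) + c * (x 0 i - I / n%:R)))).
  by apply: ler_sum => i _; apply: (ratio_le_tangent u_ge0 (x_ge0 i)).1.
rewrite big_split /= -(mulr_sumr _ _ _ c) sumrB -/(vsum x) xI !sumr_const card_ord.
have -> : I - I / n%:R *+ n = 0.
  have [n0|n_gt0] := posnP n.
    (* Division by 0 cancels nothing here, but [I] is an empty sum, hence 0. *)
    rewrite n0 mulr0n subr0 -xI /vsum; apply: big1 => i _.
    by have := ltn_ord i; rewrite {2}n0.
  by rewrite -mulr_natr divfK ?subrr // pnatr_eq0 -lt0n.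
rewrite mulr0 addr0 -[n in _ *+ n]card_ord -sumr_const.
by apply: ler_sum => i _; rewrite mxE.
Qed.

Lemma with_total_uniform (I : R) : 0 <= I <= n%:R -> with_total I (uniform_vec n I).
Proof.
case/andP => I_ge0 I_le; split=> [i|].
  have n_gt0 : (0 : R) < n%:R by rewrite ltr0n (leq_ltn_trans _ (ltn_ord i)).
  by rewrite mxE divr_ge0 //= ler_pdivrMr ?mul1r.
rewrite /vsum (eq_bigr _ (fun i _ => mxE _ _ _ _)) sumr_const card_ord.
have [n0|n_gt0] := posnP n.
  (* For [n = 0] the bounds on [I] pin it to 0. *)
  by move: I_ge0 I_le; rewrite n0 mulr0n => *; apply/eqP; rewrite eq_le; apply/andP.
by rewrite -[LHS]mulr_natr divfK // pnatr_eq0 -lt0n.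
Qed.

Lemma Phi_single_vec (I : R) (j : 'I_n) : Phi (single_vec I j) = I / (1 + I).
Proof.
rewrite /Phi (bigD1 j) //= big1 => [|i ij]; rewrite !mxE eqxx ?eqxx.
  by rewrite mulr1 addr0.
by rewrite (negPf ij) mulr0 mul0r.
Qed.

(** Raising each denominator [1 + x 0 i] to [1 + I] lowers every term, and the new terms sum to
    [I / (1 + I)]. This also covers totals above 1, where [single_vec I j] leaves the cube. *)
Lemma Phi_single_le (I : R) (j : 'I_n) x : with_total I x ->
  Phi (single_vec I j) <= Phi x.
Proof.
case=> xC xI; have x_ge0 i : 0 <= x 0 i by case/andP: (xC i).
rewrite Phi_single_vec -{1}xI mulr_suml; apply: ler_sum => i _.
have xi_le : x 0 i <= I by rewrite -xI /vsum (bigD1 i) //= lerDl sumr_ge0.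
have xi_ge0 := x_ge0 i.
by apply: ler_wpM2l => //; rewrite lef_pV2 ?posrE; lra.
Qed.

Lemma with_total_single (I : R) (j : 'I_n) : 0 <= I <= 1 ->
  with_total I (single_vec I j).
Proof.
case/andP => I_ge0 I_le1; split=> [i|].
  by rewrite !mxE eqxx /=; case: eqP; rewrite ?mulr1 ?mulr0 ?I_ge0 ?lexx ?ler01.
rewrite /vsum (bigD1 j) //= big1 => [|i ij]; rewrite !mxE eqxx ?eqxx.
  by rewrite mulr1 addr0.
by rewrite (negPf ij) mulr0.
Qed.

(** * Transfer to [mu_vec] and to influence vectors *)

Lemma mu_vec_le x y : (mu_vec x <= mu_vec y) = (Phi y <= Phi x).
Proof.
have ln2_gt0 : 0 < ln (2 : R) by rewrite ln_gt0 // ltr1n.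
by rewrite /mu_vec /powR pnatr_eq0 /= ler_expR ler_pM2r // lerN2.
Qed.

Lemma mu_vec_lt x y : (mu_vec x < mu_vec y) = (Phi y < Phi x).
Proof. by rewrite !ltNge mu_vec_le. Qed.

Lemma influences_in_unit_cube (f : boolfun n) : in_unit_cube (influences R f).
Proof.
move=> i; rewrite mxE /influence /unifPr divr_ge0 //=.
have card_gt0 : (0 < #|{: bcube n}|)%N by apply/card_gt0P; exists [ffun=> false].
by rewrite ler_pdivrMr ?ltr0n // mul1r ler_nat max_card.
Qed.

Lemma bbt_muE (f : boolfun n) : bbt_mu R f = mu_vec (influences R f).
Proof.
rewrite /bbt_mu /mu_vec /Phi -sumrN.
rewrite (big_morph (powR 2) (id1 := 1) (op1 := *%R)) //.
- by apply: eq_bigr => i _; rewrite mxE.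
- by move=> u v; rewrite powRD // pnatr_eq0 implybT.
- exact: powRr0.
Qed.

Lemma vsum_influences (f : boolfun n) : vsum (influences R f) = total_influence R f.
Proof. by apply: eq_bigr => i _; rewrite mxE. Qed.

End PhiExtrema.

Theorem theorem3p8 (R : realType) (n : nat) :
  (* influence vectors lie in [0,1]^n *)
  (forall f : boolfun n, in_unit_cube (influences R f)) /\
  (* (i) *)
  (strictly_schur_concave_on (@in_unit_cube R n) (@Phi R n) /\
   (forall x y : 'rV[R]_n, in_unit_cube x -> in_unit_cube y ->
      permuted x y -> Phi x = Phi y)) /\
  (* (ii) *)
  ((forall f : boolfun n, bbt_mu R f = 2 `^ (- Phi (influences R f))) /\
   strictly_schur_convex_on (@in_unit_cube R n) (@mu_vec R n) /\
   (forall I : R, 0 <= I <= n%:R ->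
      (with_total I (uniform_vec n I) /\
       forall x : 'rV[R]_n, with_total I x ->
         mu_vec (uniform_vec n I) <= mu_vec x) /\
      (forall j : 'I_n,
         (I <= 1 -> with_total I (single_vec I j)) /\
         forall x : 'rV[R]_n, with_total I x ->
           mu_vec x <= mu_vec (single_vec I j)) /\
      (with_total I (capped_vec n I) /\
       forall x : 'rV[R]_n, with_total I x ->
         mu_vec x <= mu_vec (capped_vec n I))) /\
   (forall f g : boolfun n, total_influence R f = total_influence R g ->
      ((forall l, influence R f l = total_influence R f / n%:R) ->
         bbt_mu R f <= bbt_mu R g) /\
      (forall j : 'I_n, (forall l, l != j -> influence R f l = 0) ->
         bbt_mu R g <= bbt_mu R f))) /\
  (* (iii) *)
  (forall f g : boolfun n,
     total_influence R f = total_influence R g ->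
     majorizes (influences R f) (influences R g) ->
     ~ permuted (influences R f) (influences R g) ->
     bbt_mu R g < bbt_mu R f).
Proof.
have PhiC := @Phi_majorizes R n.
have mem_total (f : boolfun n) : with_total (total_influence R f) (influences R f).
  by split; [exact: influences_in_unit_cube | exact: vsum_influences].
split; first exact: influences_in_unit_cube.
split; first by split=> // x y _ _; exact: Phi_permuted.
split; last first.
  move=> f g _ maj not_perm; rewrite !bbt_muE mu_vec_lt.
  by apply: PhiC => //; exact: influences_in_unit_cube.
split; first exact: bbt_muE.
split; first by move=> x y xC yC maj not_perm; rewrite mu_vec_lt; exact: PhiC.
split=> [I I_bounds | f g fg].
  split; [|split].
  - split; first exact: with_total_uniform.
    by move=> x xI; rewrite mu_vec_le Phi_uniform_ge.
  - move=> j; split=> [I_le1 | x xI]; last by rewrite mu_vec_le Phi_single_le.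
    by apply: with_total_single; case/andP: I_bounds => ->.
  - split; first exact: with_total_capped.
    by move=> x xI; rewrite mu_vec_le Phi_capped_le.
split=> [f_unif | j f_conc]; rewrite !bbt_muE mu_vec_le.
  (* The influence vector of [f] is itself extremal; [g] has the same total, so the vector bound
     applies to it. *)
  have -> : influences R f = uniform_vec n (total_influence R f).
    by apply/rowP => i; rewrite !mxE f_unif.
  by apply: Phi_uniform_ge; rewrite fg.
(* With all other influences 0, the one at [j] is the total. *)
have -> : influences R f = single_vec (total_influence R f) j.
  apply/rowP => i; rewrite !mxE eqxx /=; case: eqVneq => [->|ij].
    by rewrite mulr1 /total_influence (bigD1 j) //= big1 ?addr0.
  by rewrite mulr0 f_conc.
by apply: Phi_single_le; rewrite fg.
Qed.
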